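(* Let $\Phi$ be of type $B_n$ and $W=W(B_n)$. Let $\mathsf{s}_1,\mathsf{s}_2$ be sections of $1\to\mathbb{Z}\Phi\to\mathbb{Z}\Phi\rtimes W\xrightarrow{\pi}W\to1$, with $\mathsf{s}_1(s_i)=\tau_{a_i\alpha_i}s_i$ and $\mathsf{s}_2(s_i)=\tau_{b_i\alpha_i}s_i$, $a_i,b_i\in\mathbb{Z}$, and put $d_i=a_i-b_i$ for $i=1,\dots,n$. Then $\mathsf{s}_1$ and $\mathsf{s}_2$ define two different elements in $H^1(W,\mathbb{Z}\Phi)$ if and only if $\overline{d_n}=1$ in $\mathbb{Z}/2\mathbb{Z}$.
   Context: $\Phi$ is the root system of type $B_n$ ($n\ge2$) in a Euclidean space $V$ spanned by it, with simple roots $\alpha_1,\dots,\alpha_n$ numbered in order along the Dynkin diagram, $\alpha_n$ being the short simple root; $W$ is its Weyl group, generated by the simple reflections $s_i=s_{\alpha_i}$. $\mathbb{Z}\Phi$ is the root lattice, with $x\in\mathbb{Z}\Phi$ written as the translation $\tau_x$ in $\mathbb{Z}\Phi\rtimes W$. A section is a group morphism $\mathsf{s}:W\to\mathbb{Z}\Phi\rtimes W$ with $\pi\circ\mathsf{s}=\mathrm{id}_W$; every section is of the form $s_i\mapsto\tau_{k_i\alpha_i}s_i$ for a unique $(k_1,\dots,k_n)\in\mathbb{Z}^n$, and every such tuple occurs. $H^1(W,\mathbb{Z}\Phi)$ is identified with the set of sections up to conjugation by elements of $\mathbb{Z}\Phi$ (a section $\mathsf{s}(g)=\tau_{f(g)}g$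 corresponds to the class of the 1-cocycle $f$), so two sections define the same element iff there is $z\in\mathbb{Z}\Phi$ with $\mathsf{s}_2(g)=\tau_z\mathsf{s}_1(g)\tau_{-z}$ for all $g\in W$. The bar denotes the class modulo $2$. *)

(* Defs.v *)
From HB Require Import structures.
From mathcomp Require Import all_boot all_order all_algebra.
From mathcomp Require Import sesquilinear.
From mathcomp Require Import boolp classical_sets reals.

Set Implicit Arguments.
Unset Strict Implicit.
Unset Printing Implicit Defensive.

Import Order.TTheory GRing.Theory Num.Theory.
Local Open Scope ring_scope.

(* The Euclidean space is a finite dimensional real vector space V with an
   arbitrary positive definite symmetric bilinear form [dot]. *)

Section Reflections.
Context {R : realType} {V : vectType R} (dot : {dot V for idfun}).

(* the Cartan number (b, a^vee) *)
Definition cartan_number (b a : V) : R := 2 * dot b a / dot a a.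

Definition reflection_fun (a v : V) : V := v - cartan_number v a *: a.

Lemma reflection_fun_linear a : linear (reflection_fun a).
Proof.
move=> k u v; rewrite /reflection_fun /cartan_number linearPl mulrDr mulrDl.
rewrite scalerDl scalerBr opprD addrACA; congr (_ + (_ - _)).
by rewrite scalerA mulrCA !mulrA.
Qed.

HB.instance Definition _ a := GRing.isLinear.Build R V V *:%R
  (reflection_fun a) (reflection_fun_linear a).

Definition reflection (a : V) : 'End(V) := linfun (reflection_fun a).

Lemma reflectionE a v : reflection a v = v - cartan_number v a *: a.
Proof. by rewrite lfunE. Qed.

Lemma reflectionK a : a != 0 ->
  (reflection a \o reflection a)%VF = \1%VF.
Proof.
move=> a0; apply/lfunP => v; rewrite comp_lfunE id_lfunE !reflectionE.
have d0 : dot a a != 0 by rewrite gt_eqF// neq0_dnorm_gt0.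
have dotR : dot (v - cartan_number v a *: a) a = - dot v a.
  by rewrite linearBl linearZl_LR /= mulfVK// mulr_natl mulr2n opprD addNKr.
by rewrite [in X in _ - X]/cartan_number dotR mulrN mulNr scaleNr opprK subrK.
Qed.

Record rootSystem := RootSystem {
  roots : seq V;
  roots_span : <<roots>>%VS = fullv;
  roots_neq0 : 0 \notin roots;
  roots_refl : forall a b, a \in roots -> b \in roots ->
    reflection a b \in roots;
  roots_int : forall a b, a \in roots -> b \in roots ->
    cartan_number b a \is a Num.int;
  roots_reduced : forall (a : V) (c : R), a \in roots -> c *: a \in roots ->
    c = 1 \/ c = -1 }.

End Reflections.

Section RootSystemTheory.
Context {R : realType} {V : vectType R} {dot : {dot V for idfun}}.
Variable Phi : rootSystem dot.

(* Reflections are involutions, so the group they generate is the set of their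
   finite products. *)
Definition is_weyl (g : 'End(V)) : bool :=
  `[< exists2 s : seq V, {subset s <= roots Phi} &
      g = \big[@comp_lfun R V V V / \1%VF]_(a <- s) reflection dot a >].

Record weyl := Weyl { weyl_val :> 'End(V); weyl_valP : is_weyl weyl_val }.
HB.instance Definition _ := [isSub for weyl_val].
HB.instance Definition _ := [Choice of weyl by <:].

Lemma is_weyl1 : is_weyl \1%VF.
Proof. by apply/asboolP; exists [::]; rewrite ?big_nil. Qed.

Lemma is_weyl_refl a : a \in roots Phi -> is_weyl (reflection dot a).
Proof.
move=> aPhi; apply/asboolP; exists [:: a].
  by move=> b; rewrite inE => /eqP->.
by rewrite big_cons big_nil comp_lfun1r.
Qed.

Lemma is_weylM g h : is_weyl g -> is_weyl h -> is_weyl (g \o h)%VF.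
Proof.
move=> /asboolP[s sP ->] /asboolP[t tP ->]; apply/asboolP; exists (s ++ t).
  by move=> b; rewrite mem_cat => /orP[/sP|/tP].
elim: s {sP} => [|b s IHs] /=; first by rewrite big_nil comp_lfun1l.
by rewrite !big_cons -comp_lfunA IHs.
Qed.

Lemma is_weyl_inv g : is_weyl g ->
  [/\ is_weyl g^-1%VF, (g^-1 \o g)%VF = \1%VF & (g \o g^-1)%VF = \1%VF].
Proof.
move=> /asboolP[s sP ->].
suff [h hW [hg gh]] : exists2 h, is_weyl h &
    let g := \big[@comp_lfun R V V V / \1%VF]_(a <- s) reflection dot a in
    (h \o g)%VF = \1%VF /\ (g \o h)%VF = \1%VF.
  move: hg gh; set g' := \big[_/_]_(_ <- _) _ => hg gh.
  have kg : lker g' == 0%VS.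
    apply/lker0P => u v /(congr1 h); rewrite -!comp_lfunE hg.
    by rewrite !id_lfunE.
  have -> : (g'^-1)%VF = h.
    by rewrite -[LHS]comp_lfun1r -gh comp_lfunA lker0_compVf// comp_lfun1l.
  by split.
elim: s sP => [|a s IHs] sP /=.
  by exists \1%VF; [exact: is_weyl1 | rewrite big_nil comp_lfun1l].
have [h hW [hg gh]] := IHs (fun b bs => sP b (@mem_behead _ (a :: s) b bs)).
have aPhi : a \in roots Phi by apply: sP; rewrite mem_head.
have a0 : a != 0 by apply: contraTneq aPhi => ->; exact: roots_neq0.
exists (h \o reflection dot a)%VF; first exact/is_weylM/is_weyl_refl.
rewrite big_cons; split.
  by rewrite -comp_lfunA (comp_lfunA (reflection _ _)) reflectionK// comp_lfun1l.
by rewrite comp_lfunA -(comp_lfunA (reflection _ _)) gh comp_lfun1r reflectionK.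
Qed.

Definition weyl_one : weyl := Weyl is_weyl1.
Definition weyl_mul (g h : weyl) : weyl :=
  Weyl (is_weylM (weyl_valP g) (weyl_valP h)).
Definition weyl_inv (g : weyl) : weyl :=
  Weyl (let: And3 gV _ _ := is_weyl_inv (weyl_valP g) in gV).

Lemma weyl_mulA : associative weyl_mul.
Proof. by move=> f g h; apply/val_inj/comp_lfunA. Qed.
Lemma weyl_mul1g : left_id weyl_one weyl_mul.
Proof. by move=> g; apply/val_inj/comp_lfun1l. Qed.
Lemma weyl_mulg1 : right_id weyl_one weyl_mul.
Proof. by move=> g; apply/val_inj/comp_lfun1r. Qed.
Lemma weyl_mulVg : left_inverse weyl_one weyl_inv weyl_mul.
Proof. by move=> g; apply/val_inj; case: (is_weyl_inv (weyl_valP g)). Qed.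
Lemma weyl_mulgV : right_inverse weyl_one weyl_inv weyl_mul.
Proof. by move=> g; apply/val_inj; case: (is_weyl_inv (weyl_valP g)). Qed.

HB.instance Definition _ := isGroup.Build weyl
  weyl_mulA weyl_mul1g weyl_mulg1 weyl_mulVg weyl_mulgV.

Definition weyl_refl (a : V) (aPhi : a \in roots Phi) : weyl :=
  Weyl (is_weyl_refl aPhi).

Definition in_rlattice : {pred V} :=
  [pred x | `[< inIntSpan (in_tuple (roots Phi)) x >]].

Lemma in_rlattice_zmod_closed : zmod_closed in_rlattice.
Proof.
split=> [|x y]; rewrite !inE.
  exists [ffun=> 0].
  by rewrite big1// => i _; rewrite ffunE mulr0z.
move=> [c ->] [d ->]; exists [ffun i => c i - d i]; rewrite -sumrB; apply: eq_bigr => i _.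
by rewrite ffunE mulrzBr.
Qed.

HB.instance Definition _ :=
  GRing.isZmodClosed.Build V in_rlattice in_rlattice_zmod_closed.

Record rlattice := RLattice {
  rlattice_val : V; rlattice_valP : rlattice_val \in in_rlattice }.
HB.instance Definition _ := [isSub for rlattice_val].
HB.instance Definition _ := [Choice of rlattice by <:].
HB.instance Definition _ := [SubChoice_isSubZmodule of rlattice by <:].

Lemma in_rlattice_root a : a \in roots Phi -> a \in in_rlattice.
Proof.
move=> aPhi; rewrite inE.
have ia : (index a (roots Phi) < size (roots Phi))%N by rewrite index_mem.
exists [ffun i => (i == Ordinal ia)%:Z].
rewrite (bigD1 (Ordinal ia))//= ffunE eqxx mulr1z nth_index//.
by rewrite big1 ?addr0// => i /negPf iF; rewrite ffunE iF mulr0z.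
Qed.

Definition rlattice_root (a : V) (aPhi : a \in roots Phi) : rlattice :=
  RLattice (in_rlattice_root aPhi).

Lemma weyl_root (g : weyl) a : a \in roots Phi -> g a \in roots Phi.
Proof.
case: g => g /= /asboolP[s sP ->] aPhi.
elim: s sP => [|b s IHs] sP; first by rewrite big_nil id_lfunE.
rewrite big_cons comp_lfunE; apply: roots_refl; first exact/sP/mem_head.
by apply: IHs => c cs; apply: sP; rewrite inE cs orbT.
Qed.

Lemma weyl_rlattice (g : weyl) (x : rlattice) : g (val x) \in in_rlattice.
Proof.
case: x => x /=; rewrite inE => -[c ->].
rewrite linear_sum rpred_sum// => i _; rewrite raddfMz rpredMz//.
exact/in_rlattice_root/weyl_root/mem_nth/ltn_ord.
Qed.

Definition weyl_act (g : weyl) (x : rlattice) : rlattice :=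
  RLattice (weyl_rlattice g x).

(* the group ZPhi >< W, an element (x, g) standing for tau_x g *)
Definition affine_weyl : Type := (rlattice * weyl)%type.
HB.instance Definition _ := Choice.on affine_weyl.

Definition aff_one : affine_weyl := (0, 1%g).
Definition aff_mul (p q : affine_weyl) : affine_weyl :=
  (p.1 + weyl_act p.2 q.1, (p.2 * q.2)%g).
Definition aff_inv (p : affine_weyl) : affine_weyl :=
  (- weyl_act p.2^-1%g p.1, p.2^-1%g).

Lemma weyl_actM g h x : weyl_act (g * h)%g x = weyl_act g (weyl_act h x).
Proof. by apply/val_inj; rewrite /= comp_lfunE. Qed.
Lemma weyl_act1 x : weyl_act 1%g x = x.
Proof. by apply/val_inj; rewrite /= id_lfunE. Qed.
Lemma weyl_actD g x y : weyl_act g (x + y) = weyl_act g x + weyl_act g y.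
Proof. by apply/val_inj; rewrite /= linearD. Qed.
Lemma weyl_act0 g : weyl_act g 0 = 0.
Proof. by apply/val_inj; rewrite /= linear0. Qed.
Lemma weyl_actN g x : weyl_act g (- x) = - weyl_act g x.
Proof. by apply/val_inj; rewrite /= linearN. Qed.

Lemma aff_mulA : associative aff_mul.
Proof.
by move=> p q r; congr pair; rewrite ?mulgA//= weyl_actD weyl_actM addrA.
Qed.
Lemma aff_mul1g : left_id aff_one aff_mul.
Proof. by case=> x g; congr pair; rewrite ?mul1g//= weyl_act1 add0r. Qed.
Lemma aff_mulg1 : right_id aff_one aff_mul.
Proof. by case=> x g; congr pair; rewrite ?mulg1//= weyl_act0 addr0. Qed.
Lemma aff_mulVg : left_inverse aff_one aff_inv aff_mul.
Proof. by case=> x g; congr pair; rewrite ?mulVg//= addNr. Qed.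
Lemma aff_mulgV : right_inverse aff_one aff_inv aff_mul.
Proof.
case=> x g; congr pair; rewrite ?mulgV//=.
by rewrite weyl_actN -weyl_actM mulgV weyl_act1 subrr.
Qed.

HB.instance Definition _ := isGroup.Build affine_weyl
  aff_mulA aff_mul1g aff_mulg1 aff_mulVg aff_mulgV.

Definition transl (x : rlattice) : affine_weyl := (x, 1%g).
Definition weyl_emb (g : weyl) : affine_weyl := (0, g).
Definition aff_proj (p : affine_weyl) : weyl := p.2.

Record group_section := GroupSection {
  section_morph :> {multiplicative weyl -> affine_weyl};
  section_morphK : cancel section_morph aff_proj }.

(* H^1(W, ZPhi) is the set of sections up to conjugation by ZPhi; the element
   defined by a section is its conjugacy class. *)
Definition H1_class (s : group_section) : set group_section :=
  [set s' : group_section | exists z : rlattice,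
    forall g, s' g = (transl z * s g * transl (- z))%g].

Record rootBase n := RootBase {
  simple_roots :> n.-tuple V;
  simple_basis : basis_of fullv simple_roots;
  simple_sub : forall i, tnth simple_roots i \in roots Phi;
  simple_sign : forall b, b \in roots Phi -> exists c : 'I_n -> nat,
    b = \sum_i tnth simple_roots i *+ c i \/
    b = - \sum_i tnth simple_roots i *+ c i }.

Definition simple_root n (Delta : rootBase n) (i : 'I_n) : rlattice :=
  rlattice_root (simple_sub Delta i).
Definition simple_refl n (Delta : rootBase n) (i : 'I_n) : weyl :=
  weyl_refl (simple_sub Delta i).

(* Cartan matrix (alpha_i, alpha_j^vee) of type B_n, the simple roots being
   numbered from 0 along the diagram, with alpha_(n-1) short. *)
Definition cartanB n (i j : 'I_n) : int :=
  if i == j then 2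
  else if (i.+1 == j :> nat) || (j.+1 == i :> nat) then
    if j.+1 == n then -2 else -1
  else 0.

Definition has_typeB n (Delta : rootBase n) : Prop :=
  forall i j : 'I_n,
    cartan_number dot (tnth Delta i) (tnth Delta j) =
      (cartanB i j)%:~R.

End RootSystemTheory.

(* Main.v *)
(* Conjugating [s1] by [tau_z] turns [a i] into [a i + <z, alpha_i^vee>], and W
   is generated by the simple reflections, so the two classes agree iff the
   system [<z, alpha_i^vee> = - d i] has a solution z in the root lattice.
   In type B_n the n-th coroot takes only even values on the root lattice, and
   when [d n] is even the system is solved by partial summation. *)
From HB Require Import structures.
Require Import Defs.
From mathcomp Require Import all_boot all_order all_algebra.
From mathcomp Require Import sesquilinear.
From mathcomp Require Import boolp classical_sets reals.
From mathcomp Require Import zify ring.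

Set Implicit Arguments.
Unset Strict Implicit.
Unset Printing Implicit Defensive.

Import Order.TTheory GRing.Theory Num.Theory.
Local Open Scope ring_scope.

(** * Reflections and coroots in a Euclidean space *)

Section Coroots.
Context {R : realType} {V : vectType R} (dot : {dot V for idfun}).

Definition coroot (a v : V) : R := cartan_number dot v a.

Lemma coroot_is_scalar a : scalar (coroot a).
Proof.
by move=> k u v; rewrite /coroot /cartan_number linearPl mulrDr mulrDl mulrCA !mulrA.
Qed.

HB.instance Definition _ a := GRing.isLinear.Build R V R *%R
  (coroot a) (coroot_is_scalar a).

Lemma dot_gt0 (a : V) : a != 0 -> 0 < dot a a.
Proof. by move=> a0; rewrite neq0_dnorm_gt0. Qed.

Lemma dotC (u v : V) : dot u v = dot v u.
Proof. by rewrite hermC expr0 mul1r. Qed.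

Lemma reflection_root_scale (k : R) a : k != 0 ->
  reflection dot (k *: a) = reflection dot a.
Proof.
move=> k0; apply/lfunP => v; rewrite !reflectionE /cartan_number.
rewrite linearZr_LR linearZl_LR linearZr_LR /= scalerA; congr (_ - _ *: _).
have [->|a0] := eqVneq a 0; first by rewrite !linear0r !mulr0 !mul0r.
have d0 : dot a a != 0 by rewrite gt_eqF// dot_gt0.
by field; rewrite k0 d0.
Qed.

Lemma reflectionKv a v : a != 0 -> reflection dot a (reflection dot a v) = v.
Proof.
by move=> /(reflectionK dot)/lfunP/(_ v); rewrite comp_lfunE id_lfunE.
Qed.

Lemma dot_reflection a u v : a != 0 ->
  dot (reflection dot a u) (reflection dot a v) = dot u v.
Proof.
move=> a0; have d0 : dot a a != 0 by rewrite gt_eqF// dot_gt0.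
rewrite !reflectionE linearBl !linearBr !linearZl_LR !linearZr_LR /=.
rewrite /cartan_number (dotC a v); field.
by rewrite d0.
Qed.

(** [reflection dot a] is an isometric involution, so conjugation by it carries the reflection in
    one vector to the reflection in the image vector. This allows a root to be replaced by one of
    smaller height. *)
Lemma reflection_conj a b : a != 0 ->
  reflection dot b =
    (reflection dot a \o (reflection dot (reflection dot a b) \o
      reflection dot a))%VF.
Proof.
move=> a0; apply/lfunP => v; rewrite !comp_lfunE.
rewrite (reflectionE dot (reflection dot a b)).
rewrite /cartan_number !dot_reflection// linearB linearZ /= !reflectionKv//.
by rewrite reflectionE.
Qed.

End Coroots.

(** * Simple reflections as generators of the Weyl group *)

Section Base.
Context {R : realType} {V : vectType R} {dot : {dot V for idfun}}.
Context {Phi : rootSystem dot} {n : nat} (Delta : rootBase Phi n).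

Lemma root_neq0 a : a \in Defs.roots Phi -> a != 0.
Proof. by apply: contraTneq => ->; exact: roots_neq0. Qed.

Lemma simple_neq0 i : tnth Delta i != 0.
Proof. exact/root_neq0/simple_sub. Qed.

Lemma coord_simple (c : 'I_n -> nat) j :
  coord (simple_roots Delta) j (\sum_i tnth Delta i *+ c i) = (c j)%:R.
Proof.
rewrite -(coord_sum_free (fun i => (c i)%:R) j (basis_free (simple_basis Delta))).
by congr coord; apply: eq_bigr => i _; rewrite (tnth_nth 0) scaler_nat.
Qed.

Lemma coord_reflection i j v :
  coord (simple_roots Delta) j (reflection dot (tnth Delta i) v) =
  coord (simple_roots Delta) j v -
    cartan_number dot v (tnth Delta i) * (j == i)%:R.
Proof.
rewrite reflectionE linearB linearZ /=; congr (_ - _ * _).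
by rewrite (tnth_nth 0) coord_free ?(basis_free (simple_basis Delta))// eq_sym.
Qed.

(** Induction on the height [\sum_i c i] of a positive root: unless the root is proportional to a
    simple one, some simple reflection sends it to a positive root of smaller height, and the two
    root reflections are conjugate. A negative root has the same reflection as its opposite. *)
Lemma weyl_ind_simple (P : weyl Phi -> Prop) :
    P 1%g -> (forall g h, P g -> P h -> P (g * h)%g) ->
    (forall i, P (simple_refl Delta i)) ->
  forall g, P g.
Proof.
move=> P1 PM Ps.
have Ppos m (c : 'I_n -> nat) b (bPhi : b \in Defs.roots Phi) :
    (\sum_i c i < m)%N -> b = \sum_i tnth Delta i *+ c i ->
    P (weyl_refl bPhi).
  elim: m => // m IHm in c b bPhi *; move=> ltcm bE.
  have b0 : 0 < dot b b by apply/dot_gt0/root_neq0.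
  (* (b, b) > 0 forces (b, alpha_i) > 0 for some alpha_i occurring in b *)
  have [i ci0 dbi] : exists2 i, (0 < c i)%N & 0 < dot b (tnth Delta i).
    apply: contrapT => nex; move: b0; rewrite {2}bE linear_sumr ltNge.
    rewrite sumr_le0// => i _; rewrite raddfMn/=.
    have [->|ci0] := posnP (c i); first by rewrite mulr0n.
    rewrite pmulrn_lle0// leNgt; apply/negP => dbi.
    by apply: nex; exists i.
  set ai := tnth Delta i in dbi *.
  have ai0 : ai != 0 := simple_neq0 i.
  have k0 : 0 < cartan_number dot b ai.
    by rewrite divr_gt0 ?mulr_gt0// dot_gt0.
  have bE' : forall j, coord (simple_roots Delta) j b = (c j)%:R.
    by move=> j; rewrite bE coord_simple.
  have sbPhi : reflection dot ai b \in Defs.roots Phi.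
    exact/roots_refl/bPhi/simple_sub.
  (* Only coordinate [i] changes under the reflection. If the image is negative, every other
     coordinate of [b] is both nonnegative and nonpositive, so [b] is a multiple of [ai]. *)
  have [c' [sbE|sbE]] := simple_sign Delta sbPhi; last first.
    have bZ : b = (c i)%:R *: ai.
      rewrite bE (bigD1 i)//= -/ai scaler_nat big1 ?addr0// => j ji.
      have /eqP := congr1 (coord (simple_roots Delta) j) sbE.
      rewrite coord_reflection linearN /= coord_simple bE' (negPf ji) mulr0 subr0.
      by rewrite -addr_eq0 -natrD pnatr_eq0 addn_eq0 => /andP[/eqP-> _]; rewrite mulr0n.
    suff -> : weyl_refl bPhi = simple_refl Delta i by [].
    apply/val_inj; rewrite /= bZ reflection_root_scale//.
    by rewrite pnatr_eq0 -lt0n.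
  have -> : weyl_refl bPhi =
      (simple_refl Delta i * (weyl_refl sbPhi * simple_refl Delta i))%g.
    by apply/val_inj; rewrite /= -reflection_conj.
  apply: PM (Ps i) (PM _ _ _ (Ps i)); apply: (IHm c' _ _ _ sbE).
  have c'E j : j != i -> c' j = c j.
    move=> ji; have := congr1 (coord (simple_roots Delta) j) sbE.
    rewrite coord_reflection coord_simple bE' (negPf ji) mulr0 subr0.
    by move=> /eqP; rewrite eqr_nat => /eqP.
  (* Coordinate [i] drops by the positive number [cartan_number dot b ai]. *)
  have c'i : (c' i < c i)%N.
    have := congr1 (coord (simple_roots Delta) i) sbE.
    rewrite coord_reflection coord_simple bE' eqxx mulr1 => c'iE.
    by rewrite -(ltr_nat R) -c'iE gtrBl.
  apply: leq_trans (ltcm : (_ <= m)%N).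
  by rewrite (bigD1 i)//= [X in (_ < X)%N](bigD1 i)//= (eq_bigr c) ?ltn_add2r//.
have Prefl b (bPhi : b \in Defs.roots Phi) : P (weyl_refl bPhi).
  have [c [bE|bE]] := simple_sign Delta bPhi; first exact: Ppos bE.
  have ob : reflection dot (- b) = reflection dot b.
    by rewrite -scaleN1r reflection_root_scale// oppr_eq0 oner_neq0.
  have NbPhi : - b \in Defs.roots Phi.
    have := roots_refl bPhi bPhi; rewrite reflectionE /cartan_number mulfK.
      by rewrite scaler_nat mulr2n opprD addNKr.
    by rewrite gt_eqF// dot_gt0// root_neq0.
  suff -> : weyl_refl bPhi = weyl_refl NbPhi.
    by apply: (Ppos _ c _ NbPhi (ltnSn _)); rewrite bE opprK.
  by apply/val_inj; rewrite /= ob.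
case=> g gW; have /asboolP[s sP gE] := gW.
elim: s => [|a s IHs] in g gW sP gE *.
  suff -> : Weyl gW = 1%g by [].
  by apply/val_inj; rewrite /= gE big_nil.
have aPhi : a \in Defs.roots Phi by apply: sP; rewrite mem_head.
have sPhi : {subset s <= Defs.roots Phi} by move=> b bs; apply: sP; rewrite inE bs orbT.
have hW : is_weyl Phi
    (\big[@comp_lfun R V V V / \1%VF]_(a <- s) reflection dot a).
  by apply/asboolP; exists s.
suff -> : Weyl gW = (weyl_refl aPhi * Weyl hW)%g by apply: PM (IHs _ _ _ erefl).
by apply/val_inj; rewrite /= gE big_cons.
Qed.

(** * Sections up to conjugation by translations *)

Lemma section1 (s : group_section Phi) : s 1%g = 1%g.
Proof. by apply: (mulgI (s 1%g)); rewrite -gmulfM !mulg1. Qed.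

(** [transl] turns sums into products, so conjugators compose and invert: [y - z] and [y + z]
    witness the two inclusions. *)
Lemma H1_class_eq (s1 s2 : group_section Phi) :
  H1_class s1 = H1_class s2 <-> H1_class s1 s2.
Proof.
have transl0 : transl (0 : rlattice Phi) = 1%g by [].
have translD (x y : rlattice Phi) : transl (x + y) = (transl x * transl y)%g.
  by apply/pair_equal_spec; rewrite /= weyl_act1 mulg1.
split=> [->|[z zE]].
  by exists 0 => g; rewrite oppr0 transl0 mul1g mulg1.
apply/seteqP; split=> s [y yE].
  exists (y - z) => g; rewrite yE zE opprB !mulgA -translD subrK.
  by rewrite -(mulgA _ (transl (- z))) -translD addrA addNr add0r.
by exists (y + z) => g; rewrite yE zE opprD (addrC (- y)) !translD !mulgA.
Qed.

(** For fixed [z], the elements on which conjugation by [transl z] carries [s1] to [s2] are closed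
    under products, so simple reflections suffice. There [z] minus its reflection is the coroot
    value times the simple root. *)
Lemma H1_class_simple (s1 s2 : group_section Phi) (a b : 'I_n -> int) :
    (forall i, s1 (simple_refl Delta i) =
      (transl (simple_root Delta i *~ a i) * weyl_emb (simple_refl Delta i))%g) ->
    (forall i, s2 (simple_refl Delta i) =
      (transl (simple_root Delta i *~ b i) * weyl_emb (simple_refl Delta i))%g) ->
  H1_class s1 = H1_class s2 <->
  exists z : rlattice Phi, forall i,
    coroot dot (tnth Delta i) (val z) = - (a i - b i)%:~R.
Proof.
move=> s1E s2E.
have conjE (z : rlattice Phi) i : s2 (simple_refl Delta i) =
     (transl z * s1 (simple_refl Delta i) * transl (- z))%g <->
   coroot dot (tnth Delta i) (val z) = - (a i - b i)%:~R.
  rewrite s1E s2E.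
  have valMz (x : rlattice Phi) m : val (x *~ m) = val x *~ m.
    exact: raddfMz.
  pose ai := tnth Delta i.
  have lhs : val (transl (simple_root Delta i *~ b i) *
      weyl_emb (simple_refl Delta i))%g.1 = (b i)%:~R *: ai.
    by rewrite /= linear0 addr0 valMz scaler_int.
  have rhs : val (transl z * (transl (simple_root Delta i *~ a i) *
      weyl_emb (simple_refl Delta i)) * transl (- z))%g.1 =
      ((a i)%:~R + coroot dot ai (val z)) *: ai.
    rewrite /= !id_lfunE addr0 valMz !comp_lfunE !id_lfunE linearN /=.
    rewrite reflectionE opprB -/ai -scaler_int scalerDl /coroot.
    by rewrite [val z + _]addrC -addrA; congr (_ + _); rewrite addrC subrK.
  have ai0 : ai != 0 := simple_neq0 i.
  split=> [/(congr1 (fun p => val p.1))|cE].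
    rewrite lhs rhs => /eqP; rewrite -subr_eq0 -scalerBl scaler_eq0 (negPf ai0).
    by rewrite orbF subr_eq0 rmorphB /= -/ai => /eqP ->; ring.
  apply/pair_equal_spec; split; last by rewrite /= !mul1g mulg1.
  apply/val_inj; rewrite lhs rhs -/ai cE; congr (_ *: _).
  by rewrite rmorphB /=; ring.
rewrite H1_class_eq; split=> -[z zE]; exists z; first by move=> i; exact/conjE/zE.
apply: weyl_ind_simple => [|g h gE hE|i]; last exact/conjE/zE.
  rewrite !section1 mulg1.
  by apply/pair_equal_spec; rewrite /= weyl_act1 subrr mulg1.
rewrite !gmulfM gE hE !mulgA -(mulgA _ (transl (- z)) (transl z)).
suff -> : (transl (- z) * transl z = 1)%g by rewrite mulg1.
by apply/pair_equal_spec; rewrite /= weyl_act1 addNr mulg1.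
Qed.

(** * Parity of the last coroot on the root lattice *)

Lemma coroot_last_even (l : 'I_n) (z : rlattice Phi) :
    has_typeB Delta -> l.+1 = n ->
  exists k : int, coroot dot (tnth Delta l) (val z) = (k * 2)%:~R.
Proof.
move=> typeB lE; case: z => z /=; rewrite inE => -[c ->].
pose even (x : R) := exists k : int, x = (k * 2)%:~R.
have even_sum (I : finType) (F : I -> R) : (forall i, even (F i)) -> even (\sum_i F i).
  move=> Fe; apply: (big_ind even) => [|x y [p ->] [q ->]|i _]; last exact: Fe.
    by exists 0; rewrite mul0r.
  by exists (p + q); rewrite mulrDl rmorphD.
have even_mul x (m : int) : even x -> even (x *~ m).
  by move=> [k ->]; exists (k * m); rewrite -mulrzr -rmorphM mulrAC.
(* The entries [cartanB i l] of the last column are 2, -2 or 0. *)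
have even_simple i : even (coroot dot (tnth Delta l) (tnth Delta i)).
  rewrite /coroot typeB /cartanB lE eqxx.
  by case: ifP => _; [exists 1|case: ifP => _; [exists (-1)|exists 0]].
rewrite linear_sum; apply: (even_sum) => i; rewrite raddfMz; apply: (even_mul).
(* Lattice elements are given as combinations of all roots, so each root is expanded in simple
   roots. *)
have [m bE] := simple_sign Delta (mem_nth 0 (ltn_ord i)).
have me : even (coroot dot (tnth Delta l) (\sum_j tnth Delta j *+ m j)).
  rewrite linear_sum; apply: (even_sum) => j; rewrite raddfMn.
  exact: (even_mul _ (Posz (m j)) (even_simple j)).
case: bE => -> //; rewrite raddfN.
exact: (even_mul _ (-1) me).
Qed.

End Base.

(** * The integral linear system of the Cartan matrix *)

Lemma sum_ord_delta n (F : nat -> int) m :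
  \sum_(j < n) F j * (j == m :> nat)%:Z = if (m < n)%N then F m else 0.
Proof.
case: ifP => [lt_mn|/negP nlt].
  rewrite (bigD1 (Ordinal lt_mn))//= eqxx mulr1 big1 ?addr0// => j.
  by rewrite -val_eqE /= => /negPf->; rewrite mulr0.
rewrite big1// => j _; case: eqP => [jm|_]; last by rewrite mulr0.
by case: nlt; rewrite -jm.
Qed.

(** A column before the last acts as a negated second difference; in the last one the entry -2
    leaves twice a first difference. The shift to [C j.+1] with [C 0 = 0] supplies the missing left
    neighbour of the first node. *)
Lemma sum_cartanB l (C : nat -> int) (i : 'I_l.+1) : C 0%N = 0 ->
  \sum_(j < l.+1) C j.+1 * cartanB j i =
    if i == l :> nat then (C i.+1 - C i) * 2
    else (C i.+1 - C i) - (C i.+2 - C i.+1).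
Proof.
(* For [i = 0] the left neighbour gets the out-of-range value [l.+1], so its Kronecker delta
   vanishes on all indices. *)
move=> C0; pose prev := if (i : nat) is j.+1 then j else l.+1.
have prevE : (if (prev < l.+1)%N then C prev.+1 else 0) = C i.
  rewrite /prev {prev}; case: i => -[|i] lti /=; first by rewrite ltnn C0.
  by rewrite ltnW.
have prevP (j : 'I_l.+1) : (j.+1 == i :> nat) = (j == prev :> nat).
  rewrite /prev {prevE prev}; case: i => -[|i] lti //=.
  by apply/esym/negbTE; rewrite ltn_eqF.
case: ifPn => il.
  under eq_bigr => j _.
    have -> : C j.+1 * cartanB j i = 2 * (C j.+1 * (j == i :> nat)%:Z) -
        2 * (C j.+1 * (j == prev :> nat)%:Z).
      rewrite -prevP /cartanB -val_eqE /=.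
      have := ltn_ord j; case: eqP => [->|ji] ltj; first by lia.
      case: eqP => [e|e] /=; last first.
        by case: eqP => [f|f]; lia.
      rewrite eqSS il; lia.
    over.
  by rewrite sumrB -!mulr_sumr !(sum_ord_delta _ (C \o succn)) /= prevE ltn_ord; ring.
under eq_bigr => j _.
  have -> : C j.+1 * cartanB j i = 2 * (C j.+1 * (j == i :> nat)%:Z) -
      C j.+1 * (j == prev :> nat)%:Z - C j.+1 * (j == i.+1 :> nat)%:Z.
    rewrite -prevP /cartanB -val_eqE /= eqSS (negPf il).
    by do 3?case: eqP => ? /=; lia.
  over.
rewrite !sumrB -!mulr_sumr !(sum_ord_delta _ (C \o succn)) /= prevE ltn_ord.
by rewrite ltnS ltn_neqAle il -ltnS ltn_ord /=; ring.
Qed.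

(** With [e j = C j.+1 - C j], the equations become [e i - e i.+1 = d i] before the last node and
    [e l * 2 = d ord_max] at it. Solving backwards from [e l = h] gives [e], and summing [e] gives
    [C]. *)
Lemma cartanB_solve l (d : 'I_l.+1 -> int) (h : int) :
    d ord_max = h * 2 ->
  exists c : 'I_l.+1 -> int, forall i, \sum_j c j * cartanB j i = d i.
Proof.
move=> dh; pose e (j : nat) := h + \sum_(j <= k < l) d (inord k).
pose C (m : nat) := \sum_(j < m) e j.
exists (fun j => C j.+1) => i; rewrite sum_cartanB; last by rewrite /C big_ord0.
have CS m : C m.+1 - C m = e m by rewrite /C big_ord_recr addrC addKr.
rewrite !CS; case: eqP => [il|il].
  rewrite /e il big_geq// addr0 -dh; congr d; exact/val_inj.
have lt_il : (i < l)%N by have := ltn_ord i; lia.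
by rewrite /e (big_ltn lt_il) inord_val; ring.
Qed.

(** * The criterion modulo 2 *)

Lemma intr_Z2_eq1 (m : int) :
  (m%:~R = 1 :> 'Z_2) <-> ~ exists k : int, m = k * 2.
Proof.
have two0 : (2%:~R : 'Z_2) = 0 by exact/val_inj.
rewrite [in X in X <-> _](divz_eq m 2) rmorphD rmorphM /= two0 mulr0 add0r.
have : (m %% 2)%Z = 0 \/ (m %% 2)%Z = 1 by lia.
case=> r; rewrite r; split=> //.
  by case; exists (m %/ 2)%Z; lia.
by move=> _ [k]; lia.
Qed.

Theorem proposition3p3 (R : realType) (V : vectType R)
    (dot : {dot V for idfun}) (Phi : rootSystem dot)
    (n : nat) (n_ge2 : (2 <= n)%N)
    (Delta : rootBase Phi n) (typeB : has_typeB Delta)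
    (s1 s2 : group_section Phi) (a b d : 'I_n -> int)
    (s1E : forall i, s1 (simple_refl Delta i) =
       (transl (simple_root Delta i *~ a i) *
        weyl_emb (simple_refl Delta i))%g)
    (s2E : forall i, s2 (simple_refl Delta i) =
       (transl (simple_root Delta i *~ b i) *
        weyl_emb (simple_refl Delta i))%g)
    (dE : forall i, d i = a i - b i)
    (l : 'I_n) (lE : l.+1 = n) :
  H1_class s1 <> H1_class s2 <-> (d l)%:~R = 1 :> 'Z_2.
Proof.
rewrite intr_Z2_eq1 (H1_class_simple s1E s2E); apply: not_iff_compat.
split=> [[z zE]|[k dl]].
  have [k kE] := coroot_last_even z typeB lE.
  (* The last equation reads [k * 2 = - d l], whence the sign; it holds in [R] and is brought back
     to the integers by [eqr_int]. *)
  exists (- k); apply/eqP.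
  by rewrite -(eqr_int R) dE mulNr rmorphN /= -kE zE opprK.
have [c cE] : exists c : 'I_n -> int, forall i, \sum_j c j * cartanB j i = - d i.
  (* Writing [n] as a successor makes [ord_max] available; [lE] identifies it with [l], and half of
     [- d l] is [- k]. *)
  case: n => [//|m] in l lE d dl {n_ge2 Delta typeB a b s1E s2E dE} *.
  apply: (@cartanB_solve _ _ (- k)); rewrite mulNr -dl; congr (- d _).
  by apply/val_inj; case: lE.
exists (\sum_j simple_root Delta j *~ c j) => i.
have -> : val (\sum_j simple_root Delta j *~ c j) = \sum_j tnth Delta j *~ c j.
  by rewrite raddf_sum; apply: eq_bigr => j _; exact: raddfMz.
rewrite -dE -rmorphN -cE linear_sum rmorph_sum /=; apply: eq_bigr => j _.
by rewrite raddfMz /= /coroot typeB rmorphM -mulrzl.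
Qed.
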